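(* For all positive integers $m,n$, $$\gamma^{p}_{I}(K_m\,\square\, K_n)=\begin{cases} n, & m=n,\\ \min\{2m,2n\}, & m\ne n,\end{cases}$$ where $K_k$ denotes the complete graph on $k$ vertices.
   Context: All graphs are finite and simple. A perfect Italian dominating function (PID-function) of a graph $G$ is a function $f:V(G)\to\{0,1,2\}$ such that for every vertex $v$ with $f(v)=0$ we have $\sum_{u\in N(v)}f(u)=2$, where $N(v)$ is the open neighborhood of $v$. Its weight is $\sum_{u\in V(G)}f(u)$. The perfect Italian domination number $\gamma^{p}_{I}(G)$ is the minimum weight of a PID-function of $G$. The Cartesian product $G\square H$ has vertex set $V(G)\times V(H)$, with $(u_1,v_1)$ adjacent to $(u_2,v_2)$ iff either $u_1=u_2$ and $v_1v_2\in E(H)$, or $v_1=v_2$ and $u_1u_2\in E(G)$. *)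

(* Defs.v *)
From HB Require Import structures.
From mathcomp Require Import all_boot.

Set Implicit Arguments.
Unset Strict Implicit.
Unset Printing Implicit Defensive.

Record sgraph := SGraph {
  vertex :> finType;
  adj : rel vertex;
  adj_sym : symmetric adj;
  adj_irr : irreflexive adj }.

Arguments adj {G} u v : rename.

Definition complete_adj n : rel 'I_n := fun i j => i != j.

Lemma complete_adj_sym n : symmetric (@complete_adj n).
Proof. by move=> i j; rewrite /complete_adj eq_sym. Qed.

Lemma complete_adj_irr n : irreflexive (@complete_adj n).
Proof. by move=> i; rewrite /complete_adj eqxx. Qed.

Definition complete_graph n : sgraph :=
  SGraph (@complete_adj_sym n) (@complete_adj_irr n).

Section CartesianProduct.
Variables G H : sgraph.

Definition box_adj : rel (G * H) := fun x y =>
  (x.1 == y.1) && adj x.2 y.2 || (x.2 == y.2) && adj x.1 y.1.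

Lemma box_adj_sym : symmetric box_adj.
Proof.
move=> x y; rewrite /box_adj (eq_sym x.1) (eq_sym x.2).
by rewrite (adj_sym x.1) (adj_sym x.2).
Qed.

Lemma box_adj_irr : irreflexive box_adj.
Proof. by move=> x; rewrite /box_adj !adj_irr !andbF. Qed.

Definition box_graph : sgraph := SGraph box_adj_sym box_adj_irr.

End CartesianProduct.

Section PerfectItalianDomination.
Variable G : sgraph.
Implicit Type f : {ffun G -> 'I_3}.

Definition PID f : bool :=
  [forall v : G, (f v == 0 :> nat) ==> (\sum_(u : G | adj v u) f u == 2)].

Definition weight f : nat := \sum_(u : G) f u.

Definition all_one : {ffun G -> 'I_3} := [ffun=> inord 1].

Lemma PID_all_one : PID all_one.
Proof. by apply/forallP => v; rewrite ffunE inordK. Qed.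

(* [all_one] only witnesses, through [PID_all_one], that the set of
   PID-functions minimized over is nonempty. *)
Definition perfect_italian_number : nat :=
  weight [arg min_(f < all_one | PID f) weight f].

Lemma perfect_italian_number_attained :
  exists2 f, PID f & weight f = perfect_italian_number.
Proof.
rewrite /perfect_italian_number.
by case: arg_minnP => [|f fP _]; [exact: PID_all_one | exists f].
Qed.

Lemma perfect_italian_number_le f : PID f -> perfect_italian_number <= weight f.
Proof.
rewrite /perfect_italian_number.
by case: arg_minnP => [|g _ gmin]; [exact: PID_all_one | exact: gmin].
Qed.

End PerfectItalianDomination.

(* Main.v *)
(** Read a function on K_m □ K_n as an m × n matrix over {0,1,2}: the PID
condition says that the row sum and the column sum through every zero entry
add up to 2.  If some line has sum 0, all lines in the other direction have
sum 2.  Otherwise let m < n and suppose that the row i has sum 1.  It has a zero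
entry, whose column has sum 1 and hence a single nonzero entry, in a row k say;
so all rows other than k have sum 1.  The total is at least n > m, so the row k
has sum at least 2 and cannot contain a zero: the total is at least
(m - 1) + n >= 2m. *)
Require Import Defs.
From mathcomp Require Import all_boot zify.

Set Implicit Arguments.
Unset Strict Implicit.
Unset Printing Implicit Defensive.

(** Summing over the whole row and column is harmless, since the shared entry is zero. Keeping [I]
    and [J] separate lets rows and columns be exchanged. *)
Definition perfect_matrix (I J : finType) (F : I -> J -> nat) : Prop :=
  forall i j, F i j = 0 -> \sum_b F i b + \sum_a F a j = 2.

Lemma perfect_matrix_tr (I J : finType) (F : I -> J -> nat) :
  perfect_matrix F -> perfect_matrix (fun j i => F i j).
Proof. by move=> hF j i /hF; rewrite addnC. Qed.

Lemma sum_ge_card (I : finType) (c : nat) (F : I -> nat) :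
  (forall i, c <= F i) -> #|I| * c <= \sum_i F i.
Proof. by move=> hF; rewrite -sum_nat_const; apply: leq_sum. Qed.

Lemma perfect_matrix_row0 (I J : finType) (F : I -> J -> nat) (i : I) :
  perfect_matrix F -> \sum_b F i b = 0 -> \sum_a \sum_b F a b = #|J| * 2.
Proof.
move=> hF Ri; rewrite exchange_big -sum_nat_const; apply: eq_bigr => j _.
have /eqP := Ri; rewrite sum_nat_eq0 => /forallP/(_ j)/eqP Fij.
by have := hF _ _ Fij; rewrite Ri.
Qed.

Lemma sum1_has_zero (J : finType) (F : J -> nat) :
  1 < #|J| -> \sum_b F b = 1 -> exists j, F j = 0.
Proof.
move=> J1 S1; case: (boolP [exists j, F j == 0]) => [/existsP[j /eqP]|].
  by exists j.
move=> /existsPn F0.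
have : #|J| * 1 <= \sum_b F b by apply: sum_ge_card => j; rewrite lt0n.
lia.
Qed.

(** Either some row vanishes and the total is [2 * #|J|], or each of the [#|J|] rows contributes at
    least 1. *)
Lemma perfect_matrix_square_ge (I J : finType) (F : I -> J -> nat) :
  perfect_matrix F -> #|I| = #|J| -> #|J| <= \sum_a \sum_b F a b.
Proof.
move=> hF IJ; case: (boolP [exists i, \sum_b F i b == 0]) => [/existsP[i]|].
  by move=> /eqP/(perfect_matrix_row0 hF) ->; rewrite leq_pmulr.
move=> /existsPn Rpos; rewrite -IJ -[leqLHS]muln1.
by apply: sum_ge_card => i; rewrite lt0n.
Qed.

Lemma perfect_matrix_rect_ge (I J : finType) (F : I -> J -> nat) :
  0 < #|I| -> perfect_matrix F -> #|I| < #|J| ->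
  2 * #|I| <= \sum_a \sum_b F a b.
Proof.
move=> I0 hF IJ.
case: (boolP [exists i, \sum_b F i b == 0]) => [/existsP[i /eqP]|].
  by move=> /(perfect_matrix_row0 hF) ->; lia.
move=> /existsPn Rpos.
case: (boolP [exists j, \sum_a F a j == 0]) => [/existsP[j /eqP]|].
  move=> /(perfect_matrix_row0 (perfect_matrix_tr hF)).
  by rewrite exchange_big => ->; lia.
move=> /existsPn Cpos.
case: (boolP [exists i, \sum_b F i b == 1]) => [/existsP[i /eqP Ri]|]; last first.
  move=> /existsPn R1; rewrite mulnC; apply: sum_ge_card => i.
  by move: (Rpos i) (R1 i); lia.
have [j Fij] := sum1_has_zero (leq_ltn_trans I0 IJ) Ri.
have Cj : \sum_a F a j = 1 by have := hF _ _ Fij; lia.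
have /eqP/sum_nat_eq1[k [_ _ Fk]] := Cj.
(* Such a row meets the column [j] in a zero, and that column has sum 1. *)
have R1 a : a != k -> \sum_b F a b = 1 by move=> /Fk/(_ isT)/hF; lia.
have WE : \sum_a \sum_b F a b = \sum_b F k b + #|I|.-1.
  rewrite (bigD1 k) //= (eq_bigr _ R1) sum1_card; congr addn.
  by rewrite -(cardC1 k); apply: eq_card.
have : #|J| <= \sum_a \sum_b F a b.
  rewrite exchange_big -[leqLHS]muln1.
  by apply: sum_ge_card => b; rewrite lt0n.
rewrite WE => Wn; suff : #|J| * 1 <= \sum_b F k b by lia.
(* A zero in the row [k], whose column sum is positive, would force the row sum down to at most 1,
   but [Wn] makes it at least 2. *)
apply: sum_ge_card => b; rewrite lt0n; apply/eqP => /hF.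
by have := Cpos b; lia.
Qed.

Section Rook.
Variables m n : nat.
Local Notation G := (box_graph (complete_graph m) (complete_graph n)).

Lemma box_complete_nbr_sum (f : G -> nat) (i : 'I_m) (j : 'I_n) :
  f (i, j) = 0 ->
  \sum_(u : G | adj ((i, j) : G) u) f u = \sum_b f (i, b) + \sum_a f (a, j).
Proof.
(* The entry at [(i, j)] is zero, so it is removed from both sums on the right; the neighbours are
   then split by whether they lie in the row [i]. *)
move=> f0; rewrite (bigD1 j) //= f0 add0n (bigD1 (P := xpredT) i) //= f0 add0n.
rewrite (bigID (fun u : G => u.1 == i)) /=; congr addn.
- rewrite (reindex_onto (fun b => (i, b) : G) (fun u : G => u.2)) /=.
    apply: eq_bigl => b.
    by rewrite /box_adj /= /complete_adj !eqxx !andbT andbF orbF eq_sym.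
  by case=> a b /= /andP[_ /eqP->].
- rewrite (reindex_onto (fun a => (a, j) : G) (fun u : G => u.1)) /=.
    apply: eq_bigl => a.
    by rewrite /box_adj /= /complete_adj !eqxx !andbF !andbT /= eq_sym andbb.
  case=> a b /=; rewrite /box_adj /= /complete_adj.
  by rewrite (eq_sym i); case: eqP => //= _; case: eqP => //= ->.
Qed.

Lemma PID_perfect_matrix (f : {ffun G -> 'I_3}) :
  PID f <-> perfect_matrix (fun i j => f (i, j) : nat).
Proof.
split=> [/forallP fP i j f0 | fP].
  by have /implyP/(_ (introT eqP f0))/eqP := fP (i, j);
    rewrite (@box_complete_nbr_sum (fun u => f u)).
apply/forallP => -[i j]; apply/implyP => /eqP f0.
by rewrite (@box_complete_nbr_sum (fun u => f u)) // fP.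
Qed.

Lemma weight_matrix (f : {ffun G -> 'I_3}) :
  weight f = \sum_i \sum_j f (i, j).
Proof. by rewrite pair_big; apply: eq_bigr => -[]. Qed.

Lemma perfect_italian_number_ge c :
  (forall F : 'I_m -> 'I_n -> nat, perfect_matrix F ->
     c <= \sum_i \sum_j F i j) ->
  c <= perfect_italian_number G.
Proof.
move=> hc; have [f fP <-] := perfect_italian_number_attained G.
by rewrite weight_matrix; apply: hc; apply/PID_perfect_matrix.
Qed.

Lemma perfect_italian_number_le_matrix (F : 'I_m -> 'I_n -> nat) :
  (forall i j, F i j < 3) -> perfect_matrix F ->
  perfect_italian_number G <= \sum_i \sum_j F i j.
Proof.
(* [inord] would send values above 2 to 0; [F3] rules this out. *)
move=> F3 hF; pose f : {ffun G -> 'I_3} := [ffun u => inord (F u.1 u.2)].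
have fE i j : f (i, j) = F i j :> nat by rewrite ffunE inordK.
have <- : weight f = \sum_i \sum_j F i j.
  by rewrite weight_matrix; do 2!apply: eq_bigr => ? _.
apply/perfect_italian_number_le/PID_perfect_matrix => i j.
rewrite fE => /hF Fij; apply: etrans Fij.
by congr addn; apply: eq_bigr => ? _.
Qed.

End Rook.

Lemma sum_delta (I : finType) (c : nat) (i : I) :
  \sum_a c * (a == i) = c.
Proof.
rewrite (bigD1 i) //= eqxx muln1 big1 ?addn0 // => a /negPf->.
by rewrite muln0.
Qed.

(** A zero entry sees 2 in its row and nothing in its column. The total [2 * #|I|] gives one upper
    bound, the transpose gives the other. *)
Lemma perfect_matrix_column (I J : finType) (j0 : J) :
  perfect_matrix (fun (_ : I) (j : J) => 2 * (j == j0)).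
Proof.
move=> i j; rewrite sum_delta; case: eqP => //= _ _.
by rewrite big1.
Qed.

(** All line sums of the identity matrix are 1; its total [#|I|] is optimal in the square case. The
    factor 1 matches the form of [sum_delta]. *)
Lemma perfect_matrix_diag (I : finType) :
  perfect_matrix (fun i j : I => 1 * (j == i)).
Proof.
move=> i j _; rewrite sum_delta.
by under eq_bigr do rewrite eq_sym; rewrite sum_delta.
Qed.

Theorem theorem4p4 (m n : nat) (hm : 0 < m) (hn : 0 < n) :
  perfect_italian_number (box_graph (complete_graph m) (complete_graph n))
  = if m == n then n else minn (2 * m) (2 * n).
Proof.
apply/eqP; rewrite eqn_leq; apply/andP; split.
- case: eqP => [<-|_].
    apply: leq_trans (perfect_italian_number_le_matrix _
      (@perfect_matrix_diag 'I_m)) _.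
      by move=> i j; case: eqP.
    by under eq_bigr do rewrite sum_delta; rewrite sum1_card card_ord.
  rewrite leq_min; apply/andP; split.
    apply: leq_trans (perfect_italian_number_le_matrix _
      (@perfect_matrix_column 'I_m 'I_n (Ordinal hn))) _.
      by move=> i j; case: eqP.
    by under eq_bigr do rewrite sum_delta; rewrite sum_nat_const card_ord mulnC.
  apply: leq_trans (perfect_italian_number_le_matrix _
    (perfect_matrix_tr (@perfect_matrix_column 'I_n 'I_m (Ordinal hm)))) _.
    by move=> i j; case: eqP.
  rewrite exchange_big.
  by under eq_bigr do rewrite sum_delta; rewrite sum_nat_const card_ord mulnC.
- apply: perfect_italian_number_ge => F hF.
  case: (ltngtP m n) => mn.
  + have -> : minn (2 * m) (2 * n) = 2 * m by lia.
    by have := @perfect_matrix_rect_ge _ _ F _ hF; rewrite !card_ord; apply.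
  + have -> : minn (2 * m) (2 * n) = 2 * n by lia.
    rewrite exchange_big; have := perfect_matrix_rect_ge _ (perfect_matrix_tr hF).
    by rewrite !card_ord; apply.
  + by have := perfect_matrix_square_ge hF; rewrite !card_ord; apply.
Qed.
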